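(* Let $R$, $S$ and $T$ be admissible topological rings, and let $\varepsilon_R : R \to T$ and $\varepsilon_S : S \to T$ be continuous ring homomorphisms, with $R\neq T$ and $S\neq T$. Then the fiber product (pullback) $R\times_T S=\{(r,s)\in R\times S \mid \varepsilon_R(r)=\varepsilon_S(s)\}$ is also an admissible ring.
   Context: All rings are commutative. A topological ring $R$ is linearly topologized if $0$ has a fundamental system of neighbourhoods consisting of ideals. An ideal $\mathfrak{a}\subseteq R$ of a linearly topologized ring, with fundamental system of open ideals $\{\mathfrak{a}_\lambda\}_{\lambda\in\Lambda}$, is an ideal of definition if it is open ($\mathfrak{a}_\lambda\subseteq\mathfrak{a}$ for some $\lambda$) and topologically nilpotent (for every $\mu\in\Lambda$ there is $n\ge 0$ with $\mathfrak{a}^n\subseteq \mathfrak{a}_\mu$). $R$ is complete if the natural map $R\to\varprojlim_\lambda R/\mathfrak{a}_\lambda$ is an isomorphism (in particular $R$ is separated). $R$ is admissible if it is linearly topologized, has an ideal of definition and is complete. Topology on $R\times_T S$: let $\{\mathfrak{a}_\lambda\}_{\lambda\in\Lambda}$, $\{\mathfrak{b}_\beta\}_{\beta\in\Sigma}$, $\{\mathfrak{c}_\alpha\}_{\alpha\in C}$ be fundamental systems of neighbourhoods of $0$ consisting of ideals of definition of $R$, $S$, $T$ respectively. The ring $R\times_T S$ carries the linear topology defined by the ideals $\mathfrak{a}_\lambda\times_{\mathfrak{c}_\alpha}\mathfrak{b}_\beta=\{(r,s)\in\mathfrak{a}_\lambda\times\mathfrak{b}_\beta\mid \varepsilon_R(r)=\varepsilon_S(s)\in\mathfrak{c}_\alpha\}$,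 where $(\lambda,\beta,\alpha)$ ranges over the triples with $\varepsilon_R(\mathfrak{a}_\lambda)\subseteq\mathfrak{c}_\alpha$ and $\varepsilon_S(\mathfrak{b}_\beta)\subseteq\mathfrak{c}_\alpha$. The condition $R\ne T$, $S\neq T$ is the standing assumption that the fiber product is non-trivial. *)

(* Defs.v *)
From HB Require Import structures.
From mathcomp Require Import all_boot all_order all_algebra.
From mathcomp Require Import all_classical topology tvs.

Set Implicit Arguments.
Unset Strict Implicit.
Unset Printing Implicit Defensive.

Import GRing.Theory.

Local Open Scope classical_set_scope.
Local Open Scope ring_scope.

HB.mixin Record isTopologicalComRing R
    & TopologicalZmodule R & GRing.ComPzRing R := {
  mul_continuous : continuous (fun x : R * R => x.1 * x.2)
}.

(* The zero ring is allowed, hence ComPzRing rather than ComNzRing. *)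
#[short(type="topologicalComRingType")]
HB.structure Definition TopologicalComRing :=
  {R of TopologicalZmodule R & GRing.ComPzRing R & isTopologicalComRing R}.

(* The ideals of MathComp's ring_quotient are proper; here the unit ideal is an
   ideal. *)
Record ideal (R : comPzRingType) := Ideal {
  ideal_set :> set R;
  ideal0 : ideal_set 0;
  idealD : forall x y, ideal_set x -> ideal_set y -> ideal_set (x + y);
  idealM : forall r x, ideal_set x -> ideal_set (r * x)
}.

Section ideals.
Context {R : comPzRingType}.
Implicit Types I J : set R.

Definition coset I (r : R) : set R := [set x | I (x - r)].

Definition ideal_mul I J : set R :=
  [set x | exists s : seq (R * R),
     (forall p, p \in s -> I p.1 /\ J p.2) /\ x = \sum_(p <- s) p.1 * p.2].

Fixpoint ideal_exp I (n : nat) : set R :=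
  if n is m.+1 then ideal_mul I (ideal_exp I m) else setT.

(* An element of R / a l is represented by the coset it is; the transition map
   R / a l -> R / a m, for a l contained in a m, sends the coset X to X + a m. *)
Definition transition I (X : set R) : set R := [set x + y | x in X & y in I].

Definition inverse_limit {L : Type} (a : L -> ideal R) : set (L -> set R) :=
  [set X | (forall l, exists r, X l = coset (a l) r) /\
           (forall l m, a l `<=` a m -> X m = transition (a m) (X l))].

Definition natural_map {L : Type} (a : L -> ideal R) (r : R) : L -> set R :=
  fun l => coset (a l) r.

End ideals.

Section admissible.
Context {R : topologicalComRingType}.

Definition fundamental_system {L : Type} (a : L -> ideal R) : Prop :=
  forall U : set R, nbhs (0 : R) U <-> exists l, a l `<=` U.

Definition ideal_of_definition {L : Type} (a : L -> ideal R) (I : ideal R) :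
  Prop :=
  (exists l, a l `<=` I) /\ (forall m, exists n, ideal_exp I n `<=` a m).

(* The natural map is a ring homomorphism and the topology of the limit induces
   that of R, so being an isomorphism amounts to being bijective. *)
Definition complete {L : Type} (a : L -> ideal R) : Prop :=
  set_bij [set: R] (inverse_limit a) (natural_map a).

End admissible.

Definition admissible (R : topologicalComRingType) : Prop :=
  exists (L : Type) (a : L -> ideal R),
    [/\ fundamental_system a,
        exists I, ideal_of_definition a I
      & complete a].

Definition topological_isomorphism {R T : topologicalComRingType}
    (f : {rmorphism R -> T}) : Prop :=
  exists g : T -> R, [/\ cancel f g, cancel g f, continuous f & continuous g].

Section linear_topology.

(* The ring A with the topology in which the neighbourhoods of x are the sets
   containing x + I, for I a finite intersection of members of the family; see
   linear_topologyP for a filtering family. *)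
Definition linear_topology (A : comPzRingType) (J : Type) (I : J -> ideal A) :
  Type := A.

Context {A : comPzRingType} {J : Type} (I : J -> ideal A).

HB.instance Definition _ := GRing.ComPzRing.on (linear_topology I).

Let cap (D : set J) : set A := \bigcap_(j in D) I j.

Let cap0 D : cap D 0. Proof. by move=> j _; exact: ideal0. Qed.
Let capD D x y : cap D x -> cap D y -> cap D (x + y).
Proof. by move=> hx hy j Dj; apply: idealD; [exact: hx|exact: hy]. Qed.
Let capM D r x : cap D x -> cap D (r * x).
Proof. by move=> hx j Dj; apply: idealM; exact: hx. Qed.
Let capN D x : cap D x -> cap D (- x).
Proof. by move=> hx; rewrite -mulN1r; exact: capM. Qed.

Definition linear_nbhs (x : A) : set_system A :=
  [set U | exists2 D : set J, finite_set D
         & coset (\bigcap_(j in D) I j) x `<=` U].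

HB.instance Definition _ :=
  hasNbhs.Build (linear_topology I) (linear_nbhs : linear_topology I -> _).

Let linear_nbhs_filter (x : linear_topology I) : ProperFilter (nbhs x).
Proof.
split; first by move=> [D _] /(_ x); apply; rewrite /coset /= subrr; exact: cap0.
split.
- by exists set0.
- move=> U V [D Df DU] [E Ef EV]; exists (D `|` E); first by rewrite finite_setU.
  by move=> y hy; split; [apply: DU|apply: EV] => j hj; apply: hy; [left|right].
- by move=> U V UV [D Df DU]; exists D => //; exact: subset_trans UV.
Qed.

Let linear_nbhs_singleton (x : linear_topology I) (U : set (linear_topology I)) :
  nbhs x U -> U x.
Proof. by move=> [D _]; apply; rewrite /coset /= subrr; exact: cap0. Qed.

Let linear_nbhs_nbhs (x : linear_topology I) (U : set (linear_topology I)) :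
  nbhs x U -> nbhs x (nbhs^~ U).
Proof.
move=> [D Df DU]; exists D => // y xy; exists D => // z yz; apply: DU.
by rewrite /coset /= -(subrKA y); exact: capD.
Qed.

HB.instance Definition _ := Nbhs_isNbhsTopological.Build (linear_topology I)
  linear_nbhs_filter linear_nbhs_singleton linear_nbhs_nbhs.

Let linear_sub_continuous :
  continuous (fun x : linear_topology I * linear_topology I => x.1 - x.2).
Proof.
move=> [x y] U [D Df DU].
exists (coset (cap D) x, coset (cap D) y); first by split; exists D.
move=> [x' y'] [/= hx hy]; apply: DU; rewrite /coset /=.
by rewrite opprD addrACA -opprD; apply: capD => //; exact: capN.
Qed.

HB.instance Definition _ :=
  PreTopologicalNmodule_isTopologicalZmodule.Build (linear_topology I)
    linear_sub_continuous.

Let linear_mul_continuous :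
  continuous (fun x : linear_topology I * linear_topology I => x.1 * x.2).
Proof.
move=> [x y] U [D Df DU].
exists (coset (cap D) x, coset (cap D) y); first by split; exists D.
move=> [x' y'] [/= hx hy]; apply: DU; rewrite /coset /=.
have -> : x' * y' - x * y = y' * (x' - x) + x * (y' - y) :> A.
  by rewrite !mulrBr [y' * x]mulrC addrA subrK mulrC.
by apply: capD; exact: capM.
Qed.

HB.instance Definition _ :=
  isTopologicalComRing.Build (linear_topology I) linear_mul_continuous.

Lemma linear_topologyP (j0 : J)
    (Idir : forall i j, exists k, I k `<=` I i `&` I j)
    (x : linear_topology I) (U : set (linear_topology I)) :
  nbhs x U <-> exists j, coset (I j) x `<=` U.
Proof.
split=> [[D /(@finite_seqP {classic J}) [s ->] DU]|[j jU]]; last first.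
  by exists [set j] => //; rewrite bigcap_set1.
suff [k kD] : exists k, I k `<=` cap [set` s].
  by exists k; apply: subset_trans DU => y; exact: kD.
elim: s {DU} => [|i s [k kD]]; first by exists j0.
have [l lik] := Idir i k; exists l => y /lik [yi yk] j /=.
by rewrite inE => /orP [/eqP ->//|js]; exact: kD.
Qed.

End linear_topology.

Section fiber_product.
Context {R S T : comPzRingType} (eR : {rmorphism R -> T})
  (eS : {rmorphism S -> T}).

Definition fiber_pred : {pred R * S} := [pred p | eR p.1 == eS p.2].

Record fiber_product := FiberProduct {
  fiber_val :> R * S;
  fiber_valP : fiber_val \in fiber_pred
}.

HB.instance Definition _ := [isSub for fiber_val].
HB.instance Definition _ := [Choice of fiber_product by <:].

Let fiber_subring_closed : subring_closed fiber_pred.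
Proof.
split=> [|x y|x y]; rewrite !inE ?rmorph1 // => /eqP hx /eqP hy; apply/eqP.
  by rewrite !rmorphB hx hy.
by rewrite !rmorphM hx hy.
Qed.

HB.instance Definition _ := GRing.SubChoice_isSubComPzRing.Build
  _ fiber_pred fiber_product fiber_subring_closed.

End fiber_product.

Section fiber_topology.
Context {R S T : comPzRingType} (eR : {rmorphism R -> T})
  (eS : {rmorphism S -> T}).

Section fiber_ideal.
Variables (a : ideal R) (b : ideal S) (c : ideal T).

Definition fiber_ideal_set : set (fiber_product eR eS) :=
  [set p | [/\ ideal_set a (fiber_val p).1, ideal_set b (fiber_val p).2
             & ideal_set c (eR (fiber_val p).1)]].

Let fiber_ideal0 : fiber_ideal_set 0.
Proof. by split; rewrite /= ?rmorph0; exact: ideal0. Qed.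

Let fiber_idealD p q :
  fiber_ideal_set p -> fiber_ideal_set q -> fiber_ideal_set (p + q).
Proof.
move=> [pa pb pc] [qa qb qc].
by split; rewrite /= ?rmorphD; exact: idealD.
Qed.

Let fiber_idealM p q : fiber_ideal_set q -> fiber_ideal_set (p * q).
Proof.
by move=> [qa qb qc]; split; rewrite /= ?rmorphM; exact: idealM.
Qed.

Definition fiber_ideal : ideal (fiber_product eR eS) :=
  Ideal fiber_ideal0 fiber_idealD fiber_idealM.

End fiber_ideal.

Context {L B C : Type} (a : L -> ideal R) (b : B -> ideal S) (c : C -> ideal T).

Record fiber_index := FiberIndex {
  index_l : L;
  index_b : B;
  index_c : C;
  index_lc : eR @` a index_l `<=` c index_c;
  index_bc : eS @` b index_b `<=` c index_c
}.

Definition fiber_family (i : fiber_index) : ideal (fiber_product eR eS) :=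
  fiber_ideal (a (index_l i)) (b (index_b i)) (c (index_c i)).

Definition topological_fiber_product : topologicalComRingType :=
  linear_topology fiber_family.

End fiber_topology.

Arguments fiber_family {R S T} eR eS {L B C} a b c i.

Lemma topological_fiber_productP (R S T : topologicalComRingType)
    (eR : {rmorphism R -> T}) (eS : {rmorphism S -> T})
    (L B C : Type) (a : L -> ideal R) (b : B -> ideal S) (c : C -> ideal T) :
    continuous eR -> continuous eS ->
    fundamental_system a -> fundamental_system b -> fundamental_system c ->
  @fundamental_system (topological_fiber_product eR eS a b c) _
    (fiber_family eR eS a b c).
Proof.
move=> eRc eSc afs bfs cfs U.
have nbhsE (X : topologicalComRingType) (K : Type) (d : K -> ideal X) k :
    fundamental_system d -> nbhs 0 (d k) by move=> dfs; apply/dfs; exists k.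
have aI (V : set R) n : nbhs 0 V ->
    exists2 l, a l `<=` V & eR @` a l `<=` c n.
  move=> V0; have /afs [l] : nbhs 0 (V `&` eR @^-1` c n).
    by apply: filterI => //; apply: eRc; rewrite rmorph0; exact: nbhsE.
  rewrite subsetI => -[lV lc]; exists l => //.
  by move=> _ [x xl <-]; exact: lc.
have bI (V : set S) n : nbhs 0 V ->
    exists2 m, b m `<=` V & eS @` b m `<=` c n.
  move=> V0; have /bfs [m] : nbhs 0 (V `&` eS @^-1` c n).
    by apply: filterI => //; apply: eSc; rewrite rmorph0; exact: nbhsE.
  rewrite subsetI => -[mV mc]; exists m => //.
  by move=> _ [x xm <-]; exact: mc.
have get V W n (V0 : nbhs 0 V) (W0 : nbhs 0 W) :
    exists i : fiber_index eR eS a b c,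
    [/\ a (index_l i) `<=` V, b (index_b i) `<=` W & index_c i = n].
  have [l lV lc] := aI V n V0; have [m mW mc] := bI W n W0.
  by exists (FiberIndex lc mc).
have [n0 _] : exists n, c n `<=` setT by apply/cfs; exact: filterT.
have [i0 _] := get setT setT n0 filterT filterT.
set F := fiber_family eR eS a b c.
have dir (i j : fiber_index eR eS a b c) :
    exists k, F k `<=` F i `&` F j.
  have /cfs [n nij] : nbhs 0 (c (index_c i) `&` c (index_c j)).
    by apply: filterI; exact: nbhsE.
  have [k [ka kb kc]] := get (a (index_l i) `&` a (index_l j))
    (b (index_b i) `&` b (index_b j)) n
    (filterI (nbhsE _ _ _ _ afs) (nbhsE _ _ _ _ afs))
    (filterI (nbhsE _ _ _ _ bfs) (nbhsE _ _ _ _ bfs)).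
  exists k => p [/ka [pa1 pa2] /kb [pb1 pb2]]; rewrite kc => /nij [pc1 pc2].
  by split; split.
apply: (iff_trans (linear_topologyP i0 dir 0 U)).
by split=> -[i iU]; exists i => p; have := iU p; rewrite /coset /= subr0.
Qed.

(* Main.v *)
(** Completeness says that a coherent family of residues has a unique lift.  A
coherent family in the fiber product has coordinate families in [R] and [S] that
are Cauchy, hence have limits [r] and [s]; the images of [r] and [s] in [T] agree
modulo every [c n], hence are equal because [T] is separated, and [(r, s)] is the
lift.  Every ideal of the defining family is an ideal of definition, since powers
are computed coordinatewise and the condition on the image in [T] follows from
the inclusion of the image of [a l] in [c n]. *)
Require Import Defs.
From mathcomp Require Import all_boot all_order all_algebra.
From mathcomp Require Import all_classical topology tvs.

Set Implicit Arguments.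
Unset Strict Implicit.
Unset Printing Implicit Defensive.

Import GRing.Theory.

Local Open Scope classical_set_scope.
Local Open Scope ring_scope.

Section IdealTheory.
Context {R : comPzRingType}.
Implicit Types I J : ideal R.

Lemma idealN I x : ideal_set I x -> ideal_set I (- x).
Proof. by move=> Ix; rewrite -mulN1r; exact: idealM. Qed.

Lemma idealBC I x y : ideal_set I (x - y) -> ideal_set I (y - x).
Proof. by move=> /idealN; rewrite opprB. Qed.

Lemma idealB_trans I y x z : ideal_set I (x - y) -> ideal_set I (y - z) -> ideal_set I (x - z).
Proof. by move=> xy yz; rewrite -(subrKA y); exact: idealD. Qed.

Lemma ideal_sum (I : ideal R) (K : eqType) (s : seq K) (f : K -> R) :
  (forall i, i \in s -> ideal_set I (f i)) -> ideal_set I (\sum_(i <- s) f i).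
Proof.
move=> If; rewrite big_seq; elim/big_ind: _ => //; first exact: ideal0.
exact: idealD.
Qed.

Lemma coset_eqP I x y : coset I x = coset I y <-> ideal_set I (x - y).
Proof.
split=> [xy|xy].
  have : coset I x x by rewrite /coset /= subrr; exact: ideal0.
  by rewrite xy.
by apply/seteqP; split=> z; rewrite /coset /= => zx;
   apply: idealB_trans zx _ => //; exact: idealBC.
Qed.

Lemma transition_coset I J x :
  I `<=` J -> transition J (coset I x) = coset J x.
Proof.
move=> IJ; apply/seteqP; split=> [_ [y yx [z zJ <-]]|y yx].
  by rewrite /coset /= addrAC; apply: idealD => //; exact: IJ.
exists x; first by rewrite /coset /= subrr; exact: ideal0.
by exists (y - x) => //; rewrite addrC subrK.
Qed.

(** For positive [n] the factor [r] is absorbed by the left factors, which lie in the ideal [I].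
    With [ideal_expD] and [ideal_exp0] this makes every power an ideal. *)
Lemma ideal_exp_mull I n r x : ideal_exp I n x -> ideal_exp I n (r * x).
Proof.
case: n => [//|n] [s [sI ->]].
exists [seq (r * p.1, p.2) | p <- s]; split.
  by move=> _ /mapP[p /sI [p1 p2] ->]; split=> //; exact: idealM.
by rewrite mulr_sumr big_map; apply: eq_bigr => p _ /=; rewrite mulrA.
Qed.

Lemma ideal_expD I n x y :
  ideal_exp I n x -> ideal_exp I n y -> ideal_exp I n (x + y).
Proof.
case: n => [//|n] [s [sI ->]] [t [tI ->]]; exists (s ++ t); split.
  by move=> p; rewrite mem_cat => /orP[/sI|/tI].
by rewrite big_cat.
Qed.

Lemma ideal_exp0 I n : ideal_exp I n 0.
Proof. by case: n => [//|n]; exists [::]; rewrite big_nil. Qed.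

Lemma ideal_expS_sub I n : ideal_exp I n.+1 `<=` ideal_exp I n.
Proof.
move=> x [s [sI ->]].
(* Once the power is bundled as an ideal, each product lies in it because its right factor does. *)
apply: (@ideal_sum (Ideal (@ideal_exp0 I n) (@ideal_expD I n)
  (@ideal_exp_mull I n))) => p /sI [_ p2]; exact: ideal_exp_mull.
Qed.

Lemma ideal_exp_sub I m n : (m <= n)%N -> ideal_exp I n `<=` ideal_exp I m.
Proof.
move=> /subnK <-; elim: (n - m)%N => [//|k IHk].
by rewrite addSn; apply: subset_trans IHk; exact: ideal_expS_sub.
Qed.

Lemma ideal_exp_morph (A : comPzRingType) (f : {rmorphism A -> R})
    (I : ideal A) J n x :
  (forall y, ideal_set I y -> ideal_set J (f y)) -> ideal_exp I n x -> ideal_exp J n (f x).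
Proof.
move=> IJ; elim: n x => [//|n IHn] x [s [sI ->]].
exists [seq (f p.1, f p.2) | p <- s]; split.
  by move=> _ /mapP[p /sI [p1 p2] ->]; split; [exact: IJ|exact: IHn].
by rewrite rmorph_sum big_map; apply: eq_bigr => p _; rewrite rmorphM.
Qed.

End IdealTheory.

Section Completeness.
Context {R : topologicalComRingType}.

(** Choosing representatives turns a point of the inverse limit into a coherent family of elements,
    and the kernel of the natural map is the intersection of the [a l]. Cosets are thereby replaced
    by congruences. *)
Lemma complete_coherentP (L : Type) (a : L -> ideal R) :
  complete a <->
  (forall x, (forall l, ideal_set (a l) x) -> x = 0) /\
  (forall x : L -> R, (forall l m, a l `<=` a m -> ideal_set (a m) (x l - x m)) ->
    exists r, forall l, ideal_set (a l) (r - x l)).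
Proof.
split=> [[_ inj surj]|[sep lift]].
  split=> [x ax|x xcoh].
    apply: inj; rewrite ?inE //; apply/funext => l.
    by apply/coset_eqP; rewrite subr0.
  have [|r _ rx] := surj (fun l => coset (a l) (x l)).
    split=> [l|l m lm]; first by exists (x l).
    rewrite transition_coset //; apply/coset_eqP/idealBC; exact: xcoh.
  by exists r => l; apply/coset_eqP; exact: (congr1 (@^~ l) rx).
split.
- move=> r _; split=> [l|l m lm]; first by exists r.
  by rewrite /natural_map transition_coset.
- move=> x y _ _ xy; apply/eqP; rewrite -subr_eq0; apply/eqP/sep => l.
  by apply/coset_eqP; exact: (congr1 (@^~ l) xy).
- move=> X [/choice [x Xx] Xtr].
  have [|r rx] := lift x.
    move=> l m lm; apply/coset_eqP.
    by rewrite -Xx (Xtr l m lm) Xx transition_coset.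
  by exists r => //; apply/funext => l; rewrite Xx; apply/coset_eqP.
Qed.

Lemma fundamental_nbhs (L : Type) (a : L -> ideal R) l :
  fundamental_system a -> nbhs (0 : R) (a l).
Proof. by move=> afs; apply/afs; exists l. Qed.

(** Phrasing separation through neighbourhoods makes it independent of the system of ideals that
    witnesses admissibility. *)
Lemma admissible_separated (x : R) :
  admissible R -> (forall U : set R, nbhs (0 : R) U -> U x) -> x = 0.
Proof.
move=> [L [a [afs _ /complete_coherentP [sep _]]]] Ux.
by apply: sep => l; apply: Ux; exact: fundamental_nbhs.
Qed.

(* The ideals [d i] are not compared by inclusion: for the coordinates of a
   coherent family in a fiber product only the directedness of the ideals of the
   fiber product is available. *)
Lemma admissible_cauchy_lift (K : Type) (d : K -> ideal R) (x : K -> R) :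
    admissible R -> (forall i, nbhs (0 : R) (d i)) ->
    (forall U : set R, nbhs (0 : R) U -> exists i, d i `<=` U) ->
    (forall i j, exists k,
      ideal_set (d i) (x k - x i) /\ ideal_set (d j) (x k - x j)) ->
  exists r, forall i, ideal_set (d i) (r - x i).
Proof.
move=> [L [a [afs _ /complete_coherentP [_ lift]]]] dnbhs dsmall dcauchy.
have /choice [t dt] l : exists i, d i `<=` a l.
  by apply: dsmall; exact: fundamental_nbhs.
(* The subfamily [x \o t] is coherent for [a]: [x (t l)] and [x (t m)] are both compared with a
   common [x k]. *)
have [l m lm|r rx] := lift (x \o t).
  have [k [kl km]] := dcauchy (t l) (t m).
  apply: (@idealB_trans _ _ (x k)); last exact: dt.
  by apply/idealBC/lm/dt.
(* With [a l] inside [d i], the chain [r], [x (t l)], [x k], [x i] has all its successive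
   differences in [d i]. *)
exists r => i; have /afs [l ai] := dnbhs i.
have [k [kl ki]] := dcauchy (t l) i.
apply: (@idealB_trans _ _ (x (t l))); first exact: ai.
apply: (@idealB_trans _ _ (x k)) => //.
by apply/idealBC/ai/dt.
Qed.

End Completeness.

(** By continuity the preimage of [c n] is a neighbourhood of 0, and so is its intersection with
    [V]. This supplies the inclusions that a [fiber_index] demands. *)
Lemma fundamental_preimage (R T : topologicalComRingType)
    (f : {rmorphism R -> T}) (L C : Type) (a : L -> ideal R)
    (c : C -> ideal T) (V : set R) n :
    continuous f -> fundamental_system a -> fundamental_system c ->
    nbhs (0 : R) V ->
  exists2 l, a l `<=` V & f @` a l `<=` c n.
Proof.
move=> fc afs cfs V0; have /afs [l] : nbhs (0 : R) (V `&` f @^-1` c n).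
  by apply: filterI => //; apply: fc; rewrite rmorph0; exact: fundamental_nbhs.
rewrite subsetI => -[lV lc]; exists l => //.
by move=> _ [x xl <-]; exact: lc.
Qed.

Theorem theorem2p13 (R S T : topologicalComRingType)
  (admR : admissible R) (admS : admissible S) (admT : admissible T)
  (eR : {rmorphism R -> T}) (eS : {rmorphism S -> T})
  (eR_cont : continuous eR) (eS_cont : continuous eS)
  (RneqT : ~ topological_isomorphism eR) (SneqT : ~ topological_isomorphism eS)
  (L B C : Type)
  (a : L -> ideal R) (b : B -> ideal S) (c : C -> ideal T)
  (a_fund : fundamental_system a) (b_fund : fundamental_system b)
  (c_fund : fundamental_system c)
  (a_def : forall l, ideal_of_definition a (a l))
  (b_def : forall m, ideal_of_definition b (b m))
  (c_def : forall n, ideal_of_definition c (c n)) :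
  admissible (topological_fiber_product eR eS a b c).
Proof.
pose P := topological_fiber_product eR eS a b c.
pose F := fiber_family eR eS a b c.
have F_fund : @fundamental_system P _ F by exact: topological_fiber_productP.
(* The third component can be prescribed: [n] is fixed first, and the ideals of [R] and [S] are then
   shrunk until their images fall into [c n]. *)
have F_small V W n : nbhs (0 : R) V -> nbhs (0 : S) W ->
    exists i : fiber_index eR eS a b c,
    [/\ a (index_l i) `<=` V, b (index_b i) `<=` W & index_c i = n].
  move=> V0 W0.
  have [l lV lc] := fundamental_preimage n eR_cont a_fund c_fund V0.
  have [m mW mc] := fundamental_preimage n eS_cont b_fund c_fund W0.
  by exists (FiberIndex lc mc).
have [n0 _] : exists n, c n `<=` setT by apply/c_fund; exact: filterT.
exists (fiber_index eR eS a b c), F; split=> //.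
  have [i _] := F_small setT setT n0 filterT filterT.
  exists (F i); split=> [|j]; first by exists i.
  have [_ /(_ (index_l j)) [n an]] := a_def (index_l i).
  have [_ /(_ (index_b j)) [m bm]] := b_def (index_b i).
  (* Powers decrease, so the larger exponent serves both coordinates. *)
  exists (maxn n m) => p pF.
  have pa : ideal_set (a (index_l j)) (fiber_val p).1.
    apply/an/(ideal_exp_sub (leq_maxl n m)).
    apply: (ideal_exp_morph (f := fst \o (\val : fiber_product eR eS -> _))) pF.
    by move=> q [].
  split=> //; last by apply: (index_lc (f := j)); exists (fiber_val p).1.
  apply/bm/(ideal_exp_sub (leq_maxr n m)).
  apply: (ideal_exp_morph (f := snd \o (\val : fiber_product eR eS -> _))) pF.
  by move=> q [].
apply/complete_coherentP; split=> [p Fp|x xcoh].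
  apply/val_inj/eqP; rewrite -pair_eqE; apply/andP; split; apply/eqP.
    apply: (admissible_separated admR) => U U0.
    have [i [aU _ _]] := F_small U setT n0 U0 filterT.
    by apply: aU; case: (Fp i).
  apply: (admissible_separated admS) => U U0.
  have [i [_ bU _]] := F_small setT U n0 filterT U0.
  by apply: bU; case: (Fp i).
(* Coherence compares indices only along inclusions, so [k] is taken with [F k] inside both [F i]
   and [F j]. *)
have x_cauchy i j : exists k,
    ideal_set (F i) (x k - x i) /\ ideal_set (F j) (x k - x j).
  have /F_fund [k] : nbhs (0 : P) (F i `&` F j).
    by apply: filterI; exact: fundamental_nbhs.
  by rewrite subsetI => -[ki kj]; exists k; split; exact: xcoh.
pose dR (i : fiber_index eR eS a b c) := a (index_l i).
have [|U U0|i j|r rx] := admissible_cauchy_lift (d := dR)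
  (x := fun i => (fiber_val (x i)).1) admR.
- by move=> i; exact: (fundamental_nbhs _ a_fund).
- by have [i [aU _ _]] := F_small U setT n0 U0 filterT; exists i.
- by have [k [[ki _ _] [kj _ _]]] := x_cauchy i j; exists k.
pose dS (i : fiber_index eR eS a b c) := b (index_b i).
have [|U U0|i j|s sx] := admissible_cauchy_lift (d := dS)
  (x := fun i => (fiber_val (x i)).2) admS.
- by move=> i; exact: (fundamental_nbhs _ b_fund).
- by have [i [_ bU _]] := F_small setT U n0 filterT U0; exists i.
- by have [k [[_ ki _] [_ kj _]]] := x_cauchy i j; exists k.
have eR_rx i : ideal_set (c (index_c i)) (eR (r - (fiber_val (x i)).1)).
  by apply: (index_lc (f := i)); exists (r - (fiber_val (x i)).1) => //; exact: rx.
have eS_sx i : ideal_set (c (index_c i)) (eS (s - (fiber_val (x i)).2)).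
  by apply: (index_bc (f := i)); exists (s - (fiber_val (x i)).2) => //; exact: sx.
have rs : (r, s) \in fiber_pred eR eS.
  rewrite inE /= -subr_eq0; apply/eqP/(admissible_separated admT) => U.
  move=> /c_fund [n cU]; apply: cU.
  (* An index with third component exactly [n] is chosen; modulo [c n] both [eR r] and [eS s] agree
     with the common image of the two coordinates of [x i]. *)
  have [i [_ _ <-]] := F_small setT setT n filterT filterT.
  apply: (@idealB_trans _ _ (eR (fiber_val (x i)).1)).
    by rewrite -rmorphB.
  by apply: idealBC; rewrite (eqP (fiber_valP (x i))) -rmorphB.
by exists (FiberProduct rs) => i; split; [exact: rx|exact: sx|exact: eR_rx].
Qed.
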